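(* Fix $l=2m+1$ with $m>0$, and let $x_1,\dots,x_m$ be indeterminates over $\mathbb{Z}/2$. For $1\le k\le m$ define $x_{l-k}:=x_k$, giving elements $x_1,\dots,x_{2m}$ of $\mathbb{Z}/2[x_1,\dots,x_m]$. For $m\ge i>j\ge1$ put $$R_{i,j}=x_i^4x_{2j}+x_j^4x_{2i}+x_{2i}x_{2j}+x_{i+j}^2x_{i-j}^2.$$ Then for every integer $r$ prime to $l$, each $R_{i,j}$ lies in the kernel of $\phi_r$.
   Context: For an integer $i$, $[i]=\sum x^{n^2}\in\mathbb{Z}/2[[x]]$ (here $x$ is the power series variable), summed over $n\in\mathbb{Z}$ with $n\equiv i\pmod l$. $S$ is the subring of $\mathbb{Z}/2[[x]]$ generated by $[1],\dots,[m]$. For $r$ prime to $l$, $\phi_r:\mathbb{Z}/2[x_1,\dots,x_m]\to S$ is the ring homomorphism sending $x_k$ to $[rk]$ for $1\le k\le m$. *)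

(* Defs.v *)
From HB Require Import structures.
From mathcomp Require Import all_boot all_order all_algebra.
From mathcomp Require Import zify ring.
From mathcomp Require Import boolp.
From mathcomp Require Import mpoly.

Set Implicit Arguments.
Unset Strict Implicit.
Unset Printing Implicit Defensive.

Import GRing.Theory Num.Theory.
Local Open Scope ring_scope.

Reserved Notation "{ 'powser' R }" (at level 0, format "{ 'powser'  R }").

Section PowerSeries.
Variable R : comNzRingType.

(* Formal power series over R; the wrapper keeps the Cauchy product apart from
   the pointwise ring structure on functions. *)
Record powser := PowSer { pscoef : nat -> R }.

Lemma pscoefK : cancel pscoef PowSer. Proof. by case. Qed.

HB.instance Definition _ := Choice.copy powser (can_type pscoefK).

Implicit Types f g h : powser.

Lemma powserP f g : pscoef f =1 pscoef g -> f = g.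
Proof. by case: f g => [f] [g] /= /funext ->. Qed.

Definition ps0 := PowSer (fun=> 0).
Definition ps1 := PowSer (fun n => (n == 0%N)%:R).
Definition psadd f g := PowSer (fun n => pscoef f n + pscoef g n).
Definition psopp f := PowSer (fun n => - pscoef f n).
Definition psmul f g :=
  PowSer (fun n => \sum_(k < n.+1) pscoef f k * pscoef g (n - k)).

Fact psaddA : associative psadd.
Proof. by move=> f g h; apply: powserP => n /=; rewrite addrA. Qed.
Fact psaddC : commutative psadd.
Proof. by move=> f g; apply: powserP => n /=; rewrite addrC. Qed.
Fact psadd0 : left_id ps0 psadd.
Proof. by move=> f; apply: powserP => n /=; rewrite add0r. Qed.
Fact psaddN : left_inverse ps0 psopp psadd.
Proof. by move=> f; apply: powserP => n /=; rewrite addNr. Qed.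

HB.instance Definition _ :=
  GRing.isZmodule.Build powser psaddA psaddC psadd0 psaddN.

(* Ring axioms are transported from {poly R} by truncation. *)
Let trunc n f : {poly R} := \poly_(i < n.+1) pscoef f i.

Let coef_trunc n f k : (k <= n)%N -> (trunc n f)`_k = pscoef f k.
Proof. by move=> le_kn; rewrite coef_poly ltnS le_kn. Qed.

Let pscoefM n f g (p q : {poly R}) :
    (forall k, (k <= n)%N -> p`_k = pscoef f k) ->
    (forall k, (k <= n)%N -> q`_k = pscoef g k) ->
  forall k, (k <= n)%N -> (p * q)`_k = pscoef (psmul f g) k.
Proof.
move=> Ef Eg k le_kn; rewrite coefM /=; apply: eq_bigr => i _.
by rewrite Ef ?Eg //; have := ltn_ord i; lia.
Qed.

Fact psmulA : associative psmul.
Proof.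
move=> f g h; apply: powserP => n.
have T e k : (k <= n)%N -> (trunc n e)`_k = pscoef e k by apply: coef_trunc.
rewrite -(pscoefM (T f) (pscoefM (T g) (T h)) (leqnn n)).
by rewrite -(pscoefM (pscoefM (T f) (T g)) (T h) (leqnn n)) mulrA.
Qed.

Fact psmulC : commutative psmul.
Proof.
move=> f g; apply: powserP => n.
have T e k : (k <= n)%N -> (trunc n e)`_k = pscoef e k by apply: coef_trunc.
rewrite -(pscoefM (T f) (T g) (leqnn n)).
by rewrite -(pscoefM (T g) (T f) (leqnn n)) mulrC.
Qed.

Fact psmul1 : left_id ps1 psmul.
Proof.
move=> f; apply: powserP => n /=.
rewrite big_ord_recl /= subn0 mul1r big1 ?addr0 // => i _.
by rewrite mul0r.
Qed.

Fact psmulDl : left_distributive psmul psadd.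
Proof.
move=> f g h; apply: powserP => n /=; rewrite -big_split /=.
by apply: eq_bigr => i _; rewrite mulrDl.
Qed.

Fact ps1_neq0 : ps1 != 0.
Proof. by apply/eqP => /(congr1 (pscoef^~ 0%N)) /eqP; rewrite oner_eq0. Qed.

HB.instance Definition _ :=
  GRing.Zmodule_isComNzRing.Build powser psmulA psmulC psmul1 psmulDl ps1_neq0.

End PowerSeries.

Notation "{ 'powser' R }" := (powser R) : type_scope.

Section GeneratedSubring.
Variables (A : nzRingType) (X : A -> Prop).

Definition subring_gen : {pred A} := fun a =>
  `[< forall B : {pred A},
        GRing.subring_closed B -> (forall x, X x -> x \in B) -> a \in B >].

Lemma subring_genP a :
  reflect (forall B : {pred A},
             GRing.subring_closed B -> (forall x, X x -> x \in B) -> a \in B)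
          (a \in subring_gen).
Proof. exact: asboolP. Qed.

Lemma mem_subring_gen x : X x -> x \in subring_gen.
Proof. by move=> Xx; apply/subring_genP => B _; apply. Qed.

Fact subring_gen_closed : GRing.subring_closed subring_gen.
Proof.
split=> [|a b /subring_genP Sa /subring_genP Sb|
          a b /subring_genP Sa /subring_genP Sb];
  apply/subring_genP => B BP XB; case: (BP) => B1 BB BM //.
  by apply: BB; [apply: Sa | apply: Sb].
by apply: BM; [apply: Sa | apply: Sb].
Qed.

HB.instance Definition _ :=
  GRing.isSubringClosed.Build A subring_gen subring_gen_closed.

End GeneratedSubring.

(* theta l i is the series [i] = sum of x^(n^2) over the integers n congruent
   to i modulo l.  As n ^+ 2 = N forces |n| <= N, the coefficient of x^N only
   involves the integers n = t - N with 0 <= t <= 2N. *)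
Definition theta (l : nat) (i : int) : {powser 'F_2} :=
  PowSer (fun N : nat =>
    \sum_(t < N.*2.+1 | let n := t%:Z - N%:Z in
                        (n == i %[mod l%:Z])%Z && (n ^+ 2 == N%:Z)) 1).

Definition ell (m : nat) : nat := (2 * m + 1)%N.

Definition is_theta_gen (m : nat) (f : {powser 'F_2}) : Prop :=
  exists2 k : nat, (1 <= k <= m)%N & f = theta (ell m) k%:Z.

Record thetaRing (m : nat) := ThetaRing {
  theta_val :> {powser 'F_2};
  theta_valP : theta_val \in subring_gen (is_theta_gen m) }.

HB.instance Definition _ m := [isSub for @theta_val m].
HB.instance Definition _ m := [Choice of thetaRing m by <:].
HB.instance Definition _ m :=
  [SubChoice_isSubComNzRing of thetaRing m by <:].

Lemma theta_mod l i j : (i = j %[mod l%:Z])%Z -> theta l i = theta l j.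
Proof. by move=> Eij; rewrite /theta Eij. Qed.

Lemma thetaN l i : theta l (- i) = theta l i.
Proof.
apply: powserP => N /=.
rewrite (reindex_inj rev_ord_inj) /=; apply: eq_bigl => t.
have -> : (N.*2.+1 - t.+1)%N%:Z - N%:Z = - (t%:Z - N%:Z).
  by have := ltn_ord t; lia.
rewrite sqrrN; congr (_ && _).
by rewrite !eqz_mod_dvd -opprD !dvdzE abszN.
Qed.

Lemma theta_mem m (r : int) (k : nat) :
    coprimez r (ell m)%:Z -> (1 <= k <= m)%N ->
  theta (ell m) (r * k%:Z) \in subring_gen (is_theta_gen m).
Proof.
move=> co_rl /andP[k_gt0 le_km]; set l := ell m.
have l_gt0 : (0 < l)%N by rewrite /l /ell addn1.
pose s := `|((r * k%:Z) %% l%:Z)%Z|%N.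
have Es : s%:Z = ((r * k%:Z) %% l%:Z)%Z by rewrite gez0_abs ?modz_ge0; lia.
have lt_sl : (s < l)%N by rewrite -ltz_nat Es ltz_pmod.
have s_gt0 : (0 < s)%N.
  rewrite lt0n; apply/eqP => s0.
  have: (l%:Z %| r * k%:Z)%Z by apply/dvdz_mod0P; rewrite -Es s0.
  rewrite Gauss_dvdzr 1?coprimez_sym // dvdzE /= => /(dvdn_leq k_gt0).
  by rewrite /l /ell; lia.
have -> : theta l (r * k%:Z) = theta l s%:Z.
  by apply: theta_mod; rewrite Es modz_mod.
have [le_sm | lt_ms] := leqP s m.
  by apply: mem_subring_gen; exists s; rewrite ?s_gt0.
apply: mem_subring_gen; exists (l - s)%N; first by rewrite /l /ell in lt_sl *; lia.
rewrite -thetaN; apply: theta_mod; apply/eqP; rewrite eqz_mod_dvd.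
have -> : - s%:Z - (l - s)%N%:Z = - l%:Z by lia.
by rewrite dvdzE abszN.
Qed.

(* The unique ring morphism from 'F_2 to thetaRing m. *)
Definition theta_const m (c : 'F_2) : thetaRing m := (c : nat)%:R.

Fact thetaRing_pchar2 m : 2%:R = 0 :> thetaRing m.
Proof.
apply: val_inj; rewrite rmorph_nat rmorph0; apply: powserP => n.
by rewrite mulr2n /=; case: eqP => _; apply: val_inj.
Qed.

Fact theta_natr_mod2 m (n : nat) : (n %% 2)%N%:R = n%:R :> thetaRing m.
Proof. by rewrite {2}(divn_eq n 2) natrD natrM thetaRing_pchar2 mulr0 add0r. Qed.

Fact theta_const_is_zmod_morphism m : zmod_morphism (@theta_const m).
Proof.
move=> c d; apply/eqP; rewrite eq_sym subr_eq; apply/eqP; rewrite /theta_const.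
rewrite -natrD -[RHS]theta_natr_mod2.
exact: (congr1 (fun e : 'F_2 => (e : nat)%:R) (esym (subrK d c))).
Qed.

Fact theta_const_is_monoid_morphism m : monoid_morphism (@theta_const m).
Proof.
split=> [|c d]; rewrite /theta_const //.
by rewrite -natrM -[RHS]theta_natr_mod2.
Qed.

HB.instance Definition _ m :=
  GRing.isZmodMorphism.Build 'F_2 (thetaRing m) (@theta_const m)
    (@theta_const_is_zmod_morphism m).
HB.instance Definition _ m :=
  GRing.isMonoidMorphism.Build 'F_2 (thetaRing m) (@theta_const m)
    (@theta_const_is_monoid_morphism m).

Section Phi.
Variables (m : nat) (r : int) (co_rl : coprimez r (ell m)%:Z).

Fact phi_gen_subproof (k : 'I_m) :
  theta (ell m) (r * (k.+1)%:Z) \in subring_gen (is_theta_gen m).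
Proof. by apply: theta_mem; rewrite ?ltn_ord. Qed.

(* Ordinals count from 0, so 'X_k with k : 'I_m is the indeterminate x_(k+1). *)
Definition phi : {mpoly 'F_2[m]} -> thetaRing m :=
  mmap (@theta_const m) (fun k : 'I_m => ThetaRing (phi_gen_subproof k)).

HB.instance Definition _ := GRing.RMorphism.copy phi
  (mmap (@theta_const m) (fun k : 'I_m => ThetaRing (phi_gen_subproof k))).

Lemma phiX (k : 'I_m) :
  phi 'X_k = theta (ell m) (r * (k.+1)%:Z) :> {powser 'F_2}.
Proof. by rewrite /phi mmapX mmap1U. Qed.

Lemma phi_unique (psi : {rmorphism {mpoly 'F_2[m]} -> thetaRing m}) :
    (forall k : 'I_m,
       psi 'X_k = theta (ell m) (r * (k.+1)%:Z) :> {powser 'F_2}) ->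
  psi =1 phi.
Proof.
move=> psiX p; rewrite [p]mpolyE !rmorph_sum; apply: eq_bigr => u _.
have psiC (c : 'F_2) : psi c%:MP = phi c%:MP.
  by rewrite -(natr_Zp c) !rmorph_nat.
rewrite -mul_mpolyC !rmorphM psiC mpolyXE_id !rmorph_prod; congr (_ * _).
apply: eq_bigr => k _; rewrite !rmorphXn; congr (_ ^+ _).
by apply: val_inj; exact: etrans (psiX k) (esym (phiX k)).
Qed.

End Phi.

(* xvar m k is x_k for 1 <= k <= 2m, with x_(l-k) = x_k; other k are unused. *)
Definition xvar (m k : nat) : {mpoly 'F_2[m]} :=
  let k' := if (k <= m)%N then k else (ell m - k)%N in
  if insub k'.-1 is Some t then 'X_(t : 'I_m) else 0.

Lemma xvarE m (t : 'I_m) : xvar m t.+1 = 'X_t.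
Proof. by rewrite /xvar ltn_ord /= valK. Qed.

Lemma xvar_sub m k : (1 <= k <= m)%N -> xvar m (ell m - k) = xvar m k.
Proof.
move=> k_bnd; rewrite /xvar /ell; have -> : (k <= m)%N by lia.
have -> : (2 * m + 1 - k <= m)%N = false by lia.
by rewrite subKn //; lia.
Qed.

Definition Rpoly (m i j : nat) : {mpoly 'F_2[m]} :=
  let x := xvar m in
  x i ^+ 4 * x (2 * j)%N + x j ^+ 4 * x (2 * i)%N
  + x (2 * i)%N * x (2 * j)%N + x (i + j)%N ^+ 2 * x (i - j)%N ^+ 2.

(* Main.v *)
(* Write [2a] = E_a + O_a, splitting the sum of x^(n^2) according to the parity
   of n.  Over Z/2, squaring a series substitutes x^2 for x, so [a]^4 is the sum
   of x^((2n)^2) over n = a mod l, which is E_a because l is odd.  Hence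
     [a]^4 [2b] + [b]^4 [2a] + [2a] [2b] = E_a E_b + O_a O_b,
   the sum of x^(n^2+p^2) over n = 2a, p = 2b mod l with n = p mod 2.  Putting
   n = u + v and p = u - v turns it into the sum of x^(2(u^2+v^2)) over
   u = a + b, v = a - b mod l, which is [a+b]^2 [a-b]^2. *)
Require Import Defs.
From mathcomp Require Import all_boot all_order all_algebra.
From mathcomp Require Import mpoly.
From mathcomp Require Import zify ring.

Set Implicit Arguments.
Unset Strict Implicit.
Unset Printing Implicit Defensive.

Import GRing.Theory Num.Theory.
Local Open Scope ring_scope.

(** [h] and [h'] need only be mutually inverse on the filtered lists, as for changes of variable
    between finite boxes of integers. *)
Lemma big_uniq_reindex (V : nmodType) (I J : eqType) (r : seq I) (s : seq J)
    (P : pred I) (Q : pred J) (h : J -> I) (h' : I -> J) (F : I -> V) :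
    uniq r -> uniq s ->
    (forall y, y \in s -> Q y -> [/\ h y \in r, P (h y) & h' (h y) = y]) ->
    (forall x, x \in r -> P x -> [/\ h' x \in s, Q (h' x) & h (h' x) = x]) ->
  \sum_(x <- r | P x) F x = \sum_(y <- s | Q y) F (h y).
Proof.
move=> Ur Us hP h'P; rewrite -big_filter -[RHS]big_filter -(big_map h predT F).
apply/perm_big/uniq_perm; first exact: filter_uniq.
- rewrite map_inj_in_uniq ?filter_uniq // => y z.
  rewrite !mem_filter => /andP[Qy sy] /andP[Qz sz] Eyz.
  have [_ _ <-] := hP _ sy Qy; have [_ _ <-] := hP _ sz Qz.
  by rewrite Eyz.
- move=> x; rewrite mem_filter; apply/andP/mapP => [[Px rx] | [y]].
    by have [sx Qx Ex] := h'P _ rx Px; exists (h' x); rewrite ?mem_filter ?Qx.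
  by rewrite mem_filter => /andP[Qy sy] ->; have [] := hP _ sy Qy.
Qed.

Lemma pscoefD (R : comNzRingType) (f g : {powser R}) n :
  pscoef (f + g) n = pscoef f n + pscoef g n.
Proof. by []. Qed.

Lemma pscoefM (R : comNzRingType) (f g : {powser R}) n :
  pscoef (f * g) n = \sum_(k < n.+1) pscoef f k * pscoef g (n - k).
Proof. by []. Qed.

Lemma addF2 (c : 'F_2) : c + c = 0.
Proof. by rewrite -mulr2n; exact: (mulrn_pchar (pchar_Fp (isT : prime 2))). Qed.

Lemma powser_addF2 (f : {powser 'F_2}) : f + f = 0.
Proof. by apply: powserP => n; rewrite pscoefD addF2. Qed.

Lemma sqrF2 (c : 'F_2) : c * c = c.
Proof. by case: c => [[|[|]]] // ?; apply: val_inj. Qed.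

(** The terms at k and n - k of the Cauchy product cancel in characteristic 2; only k = n/2 can
    remain, and c^2 = c in ['F_2]. *)
Lemma pscoef_sqr (f : {powser 'F_2}) n :
  pscoef (f ^+ 2) n = if odd n then 0 else pscoef f n./2.
Proof.
rewrite expr2 pscoefM (bigID (fun k : 'I_n.+1 => k + k < n)%N) /=.
rewrite [X in _ + X](bigID (fun k : 'I_n.+1 => k + k == n)%N) /= addrCA.
(* The reflection k -> n - k carries the terms with 2k > n to those with 2k < n. *)
rewrite [X in _ + (_ + X)](_ : _ = \sum_(k < n.+1 | (k + k < n)%N)
    pscoef f k * pscoef f (n - k)); last first.
  rewrite (reindex_inj rev_ord_inj) /=; apply: eq_big => k.
    by have := ltn_ord k; lia.
  move=> _; rewrite subSS mulrC; congr (pscoef f _ * _).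
  by have := ltn_ord k; lia.
rewrite addF2 addr0; case: ifPn => n_odd.
  by apply: big_pred0 => k; lia.
have lt_n2 : (n./2 < n.+1)%N by lia.
rewrite (big_pred1 (Ordinal lt_n2)) /=.
  by rewrite (_ : n - n./2 = n./2)%N ?sqrF2 //; lia.
by move=> k /=; rewrite -val_eqE /=; lia.
Qed.

Definition box (K : nat) : seq int := [seq t%:Z - K%:Z | t <- iota 0 K.*2.+1].

Lemma mem_box K n : (n \in box K) = (`|n| <= K)%N.
Proof.
apply/mapP/idP => [[t] | le_nK]; first by rewrite mem_iota => *; lia.
by exists `|(n + K%:Z)%R|%N; rewrite ?mem_iota; lia.
Qed.

Lemma box_uniq K : uniq (box K).
Proof. by rewrite map_inj_uniq ?iota_uniq // => s t; lia. Qed.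

(* The sum of x^(n^2) over the integers n with P n; n ^+ 2 = N forces
   |n| <= N. *)
Definition sqser (P : pred int) : {powser 'F_2} :=
  PowSer (fun N => \sum_(n <- box N | P n && (n ^+ 2 == N%:Z)) 1).

Lemma theta_sqser l i : theta l i = sqser (fun n => (n == i %[mod l%:Z])%Z).
Proof.
apply: powserP => N /=; rewrite /box big_map.
by rewrite -(big_mkord (fun t => let n := t%:Z - N%:Z in
  (n == i %[mod l%:Z])%Z && (n ^+ 2 == N%:Z)) (fun=> 1)) /index_iota subn0.
Qed.

(** Every n with n^2 = k already lies in [box K], so all coefficients up to K can be summed over one
    common box. *)
Lemma pscoef_sqser P K k : (k <= K)%N ->
  pscoef (sqser P) k = \sum_(n <- box K | P n && (n ^+ 2 == k%:Z)) 1.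
Proof.
move=> le_kK; rewrite /sqser /=.
apply: (@big_uniq_reindex _ _ _ _ _ _ _ id id); rewrite ?box_uniq // => n;
  by rewrite !mem_box => _ /andP[-> /eqP En]; rewrite En eqxx; split=> //; nia.
Qed.

Lemma sqser_split P Q :
  sqser P = sqser (fun n => P n && Q n) + sqser (fun n => P n && ~~ Q n).
Proof.
apply: powserP => N; rewrite pscoefD /= (bigID Q) /=.
by congr (_ + _); apply: eq_bigl => n; rewrite andbAC.
Qed.

Definition box2 K : seq (int * int) := [seq (n, p) | n <- box K, p <- box K].

Lemma mem_box2 K u : (u \in box2 K) = (`|u.1| <= K)%N && (`|u.2| <= K)%N.
Proof.
apply/allpairsP/andP => [[[n p] /=] | [le1 le2]].
  by rewrite !mem_box => -[? ? ->].
by exists u; rewrite !mem_box; case: u le1 le2.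
Qed.

Lemma box2_uniq K : uniq (box2 K).
Proof. by apply: allpairs_uniq; rewrite ?box_uniq // => -[? ?] []. Qed.

(** A pair (n, p) with n^2 + p^2 = N is counted by exactly one term of the Cauchy product, that with
    k = n^2. *)
Lemma pscoef_sqserM P Q K N : (N <= K)%N ->
  pscoef (sqser P * sqser Q) N =
  \sum_(u <- box2 K | [&& P u.1, Q u.2 & u.1 ^+ 2 + u.2 ^+ 2 == N%:Z]) 1.
Proof.
move=> le_NK; rewrite pscoefM.
transitivity (\sum_(k < N.+1) \sum_(u <- box2 K)
    if [&& P u.1, u.1 ^+ 2 == k%:Z, Q u.2 & u.2 ^+ 2 == (N - k)%N%:Z]
    then 1 else 0 : 'F_2).
  apply: eq_bigr => k _.
  rewrite !(@pscoef_sqser _ K); [|have := ltn_ord k; lia..].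
  rewrite big_allpairs_dep [X in X * _]big_mkcond.
  rewrite [X in _ * X]big_mkcond big_distrlr /=.
  apply: eq_bigr => n _; apply: eq_bigr => p _; rewrite andbA.
  by case: (P n && _); case: (Q p && _); rewrite ?mulr0 ?mul0r ?mulr1.
rewrite exchange_big [RHS]big_mkcond /=; apply: eq_bigr => -[n p] _ /=.
rewrite -big_mkcond /=; case: ifP => [/and3P[Pn Qp /eqP Enp] | D].
  have lt_nN : (`|(n ^+ 2)%R| < N.+1)%N by nia.
  rewrite (big_pred1 (Ordinal lt_nN)) // => k /=.
  by rewrite Pn Qp -val_eqE /=; have := ltn_ord k; nia.
apply: big_pred0 => k; apply: contraFF D => /and4P[-> /eqP En -> /eqP Ep] /=.
by have := ltn_ord k; lia.
Qed.

Lemma dvdz_double_odd l (x y : int) : odd l ->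
  (l%:Z %| 2 * x - 2 * y)%Z = (l%:Z %| x - y)%Z.
Proof.
by move=> l_odd; rewrite -mulrBr Gauss_dvdzr // coprimezE /= coprimen2.
Qed.

Lemma dvdz2D (n p : int) :
  (2 %| n + p)%Z = ((2 %| n)%Z == (2 %| p)%Z).
Proof. by lia. Qed.

(** Two squarings multiply exponents by 4, which amounts to n -> 2n; as l is odd, 2n = 2a mod l is
    equivalent to n = a mod l. *)
Lemma theta_pow4 l a : odd l ->
  theta l a ^+ 4 =
  sqser (fun n => (n == 2 * a %[mod l%:Z])%Z && (2 %| n)%Z).
Proof.
move=> l_odd; apply: powserP => N.
rewrite (exprM _ 2 2) !pscoef_sqr theta_sqser.
(* If 4 does not divide N both sides vanish, since the square of an even integer is a multiple of
   4. *)
have [N4 | N4] := boolP (4 %| N)%N; last first.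
  rewrite [RHS]/= [RHS]big_pred0.
    by case: ifP => // N_odd; case: ifP => // N2_odd; lia.
  by move=> n; apply/negP => /andP[/andP[_ /dvdzP[q ->]] /eqP]; nia.
have -> : odd N = false by lia.
have -> : odd N./2 = false by lia.
rewrite (@pscoef_sqser _ N); last by lia.
symmetry; apply: (@big_uniq_reindex _ _ _ _ _ _ _ (fun n => 2 * n)
  (fun n => (n %/ 2)%Z)); rewrite ?box_uniq // => n; rewrite !mem_box.
  move=> le_nN /andP[+ /eqP En]; rewrite !eqz_mod_dvd dvdz_double_odd // => ->.
  by split; [nia | apply/andP; split; [lia | apply/eqP; nia] | lia].
move=> le_nN /andP[/andP[+ /dvdzP[q Eq]] /eqP En].
have -> : (n %/ 2)%Z = q by lia.
rewrite !eqz_mod_dvd Eq mulrC dvdz_double_odd // => ->.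
by split; [nia | apply/andP; split; [lia | apply/eqP; nia] | lia].
Qed.

Lemma le_sumsqr (n p : int) (K : nat) :
  n ^+ 2 + p ^+ 2 = K%:Z -> (`|n| <= K)%N /\ (`|p| <= K)%N.
Proof. by move=> E; split; nia. Qed.

Lemma theta_rel l a b : odd l ->
  theta l a ^+ 4 * theta l (2 * b) + theta l b ^+ 4 * theta l (2 * a)
  + theta l (2 * a) * theta l (2 * b)
  + theta l (a + b) ^+ 2 * theta l (a - b) ^+ 2 = 0.
Proof.
move=> l_odd.
have split c : theta l (2 * c) = theta l c ^+ 4
    + sqser (fun n => (n == 2 * c %[mod l%:Z])%Z && ~~ (2 %| n)%Z).
  by rewrite theta_pow4 // -sqser_split theta_sqser.
rewrite !split !theta_pow4 //.
set Ea := sqser _; set Eb := sqser _; set Ob := sqser _; set Oa := sqser _.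
(* After expansion, a copy of Ea Eb + Ea Ob + Eb Oa cancels against another, leaving Ea Eb + Oa
   Ob. *)
rewrite (_ : _ + _ = (Ea * Eb + Ea * Ob + Eb * Oa)
  + (Ea * Eb + Ea * Ob + Eb * Oa) + (Ea * Eb + Oa * Ob
  + (theta l (a + b) * theta l (a - b)) ^+ 2)); last by ring.
rewrite powser_addF2 add0r.
suff -> : Ea * Eb + Oa * Ob = (theta l (a + b) * theta l (a - b)) ^+ 2.
  exact: powser_addF2.
apply: powserP => N; rewrite pscoefD !(@pscoef_sqserM _ _ N) // pscoef_sqr.
(* The pairs of even integers and the pairs of odd integers together are those with even sum. *)
transitivity (\sum_(u <- box2 N | [&& (u.1 == 2 * a %[mod l%:Z])%Z,
    (u.2 == 2 * b %[mod l%:Z])%Z, (2 %| u.1 + u.2)%Z &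
    u.1 ^+ 2 + u.2 ^+ 2 == N%:Z]) 1 : 'F_2).
  rewrite [RHS](bigID (fun u => (2 %| u.1)%Z)) /=.
  congr (_ + _); apply: eq_bigl => -[n p] /=; rewrite dvdz2D.
    by case: (2 %| n)%Z; case: (2 %| p)%Z; rewrite /= ?andbF ?andbT.
  by case: (2 %| n)%Z; case: (2 %| p)%Z; rewrite /= ?andbF ?andbT.
case: ifPn => N_odd.
  (* When n + p is even so is n^2 + p^2, hence no pair contributes to an odd N. *)
  apply: big_pred0 => -[n p] /=; apply/negP => /and4P[_ _ /dvdzP[q Eq] /eqP En].
  have En' : n = q * 2 - p by lia.
  have : N%:Z = 2 * (2 * q ^+ 2 - 2 * q * p + p ^+ 2) by rewrite -En En'; ring.
  by move: (2 * q ^+ 2 - _ + _) => w; lia.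
rewrite !theta_sqser (@pscoef_sqserM _ _ N); last by lia.
apply: (@big_uniq_reindex _ _ _ _ _ _ _ (fun u => (u.1 + u.2, u.1 - u.2))
  (fun u => (((u.1 + u.2) %/ 2)%Z, ((u.1 - u.2) %/ 2)%Z)));
  rewrite ?box2_uniq // => -[n p]; rewrite !mem_box2 /= !eqz_mod_dvd.
  (* In this direction [n] and [p] stand for u and v, and N is even. *)
  move=> _ /and3P[dn dp /eqP Enp].
  have E : (n + p) ^+ 2 + (n - p) ^+ 2 = N%:Z.
    have -> : N%:Z = 2 * (N./2)%:Z by clear dn dp; lia.
    by rewrite -Enp; ring.
  split; [by have [-> ->] := le_sumsqr E | | by congr pair; clear; lia].
  rewrite E eqxx (_ : n + p - _ = n - (a + b) + (p - (a - b))); last by ring.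
  rewrite (_ : n - p - _ = n - (a + b) - (p - (a - b))); last by ring.
  rewrite (_ : n + p + _ = n * 2); last by ring.
  by rewrite rpredD // rpredB // dvdz_mull.
move=> _ /and4P[dn dp /dvdzP[q Eq] /eqP Enp].
(* Here u = q and v = q - p, so both halvings are exact. *)
have En : n = q * 2 - p by rewrite -Eq addrK.
have -> : ((n + p) %/ 2 = q)%Z by clear dn dp; lia.
have -> : ((n - p) %/ 2 = q - p)%Z by clear dn dp; lia.
have E : q ^+ 2 + (q - p) ^+ 2 = (N./2)%:Z.
  have : N%:Z = 2 * (q ^+ 2 + (q - p) ^+ 2) by rewrite -Enp En; ring.
  by move: (q ^+ 2 + _) => w; clear dn dp; lia.
have le_N2 : (N./2 <= N)%N by clear dn dp; lia.
split; [| | by congr pair; rewrite ?En; ring].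
  by have [le1 le2] := le_sumsqr E; rewrite !(leq_trans _ le_N2).
(* The congruences for u and v are checked after doubling, which is reversible modulo the odd l. *)
rewrite E eqxx andbT -(dvdz_double_odd q) // -(dvdz_double_odd (q - p)) //.
rewrite (_ : 2 * q - _ = n - 2 * a + (p - 2 * b)); last by rewrite En; ring.
rewrite (_ : 2 * (q - p) - _ = n - 2 * a - (p - 2 * b)).
  by rewrite rpredD // rpredB.
by rewrite En; ring.
Qed.

(** For k > m, x_k is x_(l-k), and [r(l-k)] = [-r(l-k)] = [rk] because [i] is even in i and depends
    only on i mod l. *)
Lemma val_phi_xvar m (r : int) (co_rl : coprimez r (ell m)%:Z) k :
    (1 <= k <= 2 * m)%N ->
  theta_val (phi co_rl (xvar m k)) = theta (ell m) (r * k%:Z).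
Proof.
have le_m t : (1 <= t <= m)%N ->
    theta_val (phi co_rl (xvar m t)) = theta (ell m) (r * t%:Z).
  case: t => // t lt_tm; rewrite (xvarE (Ordinal lt_tm)).
  exact: phiX.
move=> k_bnd; have [le_km | lt_mk] := leqP k m; first by apply: le_m; lia.
have -> : k = (ell m - (ell m - k))%N by rewrite /ell; lia.
rewrite xvar_sub ?le_m -1?thetaN; [|by rewrite /ell; lia..].
apply: theta_mod; apply/eqP; rewrite eqz_mod_dvd.
by apply/dvdzP; exists (- r); rewrite /ell; nia.
Qed.

Theorem theorem3p8 (m : nat) (m_gt0 : (0 < m)%N)
    (i j : nat) (le_im : (i <= m)%N) (lt_ji : (j < i)%N) (j_ge1 : (1 <= j)%N)
    (r : int) (co_rl : coprimez r (ell m)%:Z) :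
  phi co_rl (Rpoly m i j) = 0.
Proof.
apply: val_inj; rewrite /Rpoly /= !(rmorphD, rmorphM, rmorphXn) /=.
(* From 1 <= j < i <= m, all indices lie between 1 and 2m. *)
rewrite !val_phi_xvar; try lia.
have l_odd : odd (ell m) by rewrite /ell; lia.
(* This brings the indices to the form of [theta_rel] with a = ri and b = rj; j < i makes the
   natural subtraction an integer one. *)
rewrite !PoszM !(mulrCA r 2) PoszD -(subzn (ltnW lt_ji)) mulrDr mulrBr.
exact: theta_rel.
Qed.
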